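(* Let $m,n,r$ be integers such that $2\leq m\leq n$, $r\geq 2$ and $(r-1)^m<n\leq r^m$. Then $$OD'^-(K_{m,n}) = \begin{cases} \lceil \frac{r}{2} \rceil, & \text{if } n \leq r^m - \lceil \log_r m \rceil -1,\\ \lceil \frac{r+1}{2} \rceil, & \text{if } n \geq r^m - \lceil \log_r m \rceil +1. \end{cases}$$ If $n=r^m - \lceil \log_r m \rceil$, then $OD'^-(K_{m,n})$ is either $\lceil r/2 \rceil$ or $\lceil (r+1)/2 \rceil$ and can be computed recursively in time $O(\log^*(n))$.
   Context: $K_{m,n}$ is the complete bipartite graph with classes of sizes $m$ and $n$, and $\log^*$ is the iterated logarithm. Write $[k]=\{1,\ldots,k\}$. An orientation of a graph $G$ is a digraph $\overrightarrow{G}$ obtained from $G$ by replacing each edge $xy$ with exactly one of the arcs $\overrightarrow{xy}$, $\overrightarrow{yx}$. Automorphisms of a digraph preserve arcs together with their directions. An arc colouring with colours from $[k]$ (no properness required) is distinguishing if the only automorphism of the digraph preserving the colours of all arcs is the identity; the distinguishing index $D'(\overrightarrow{G})$ is the least integer $k\ge1$ for which a distinguishing arc colouring with colours from $[k]$ exists. Define $OD'^-(G)=\min D'(\overrightarrow{G})$ over all orientations $\overrightarrow{G}$ of $G$. *)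

(* Defs.v *)
From mathcomp Require Import all_boot all_fingroup.

Set Implicit Arguments.
Unset Strict Implicit.
Unset Printing Implicit Defensive.

Definition least (P : nat -> Prop) (k : nat) : Prop :=
  P k /\ forall j, P j -> k <= j.

Definition complete_bipartite (m n : nat) : rel ('I_m + 'I_n) :=
  fun x y => match x, y with
             | inl _, inr _ | inr _, inl _ => true
             | _, _ => false
             end.
Arguments complete_bipartite : clear implicits.

(* A graph is given by its adjacency relation, a digraph by its arc relation:
   [d x y] means that there is an arc from x to y. *)
Definition orientation (T : finType) (e d : rel T) : Prop :=
  (forall x y, d x y -> e x y) /\ (forall x y, e x y -> d x y (+) d y x).

Definition automorphism (T : finType) (d : rel T) (s : {perm T}) : Prop :=
  forall x y, d (s x) (s y) = d x y.

(* A colouring is total on ordered pairs, but only its values on arcs matter. *)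
Definition distinguishing (T : finType) (d : rel T) (C : Type)
    (c : T -> T -> C) : Prop :=
  forall s : {perm T}, automorphism d s ->
    (forall x y, d x y -> c (s x) (s y) = c x y) -> s = 1%g.

(* Relational, because a digraph may have no distinguishing arc colouring at
   all (e.g. two isolated vertices); such a digraph has no index, which in the
   minimum below amounts to an infinite one. *)
Definition distinguishing_index (T : finType) (d : rel T) (k : nat) : Prop :=
  least (fun k => 1 <= k /\ exists c : T -> T -> 'I_k, distinguishing d c) k.

(* [OD_minus e k] : the minimum of the distinguishing index over all
   orientations of e is k. *)
Definition OD_minus (T : finType) (e : rel T) (k : nat) : Prop :=
  least (fun k => exists d : rel T,
           orientation e d /\ distinguishing_index d k) k.

(* Iterated binary logarithm: the number of times log_2 has to be applied to n
   before the result is at most 1.  Rounding each logarithm up (up_log 2)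
   does not change this number, since x <= 2 ^ a iff up_log 2 x <= a for
   integers a. *)
Lemma logstar_subproof (n : nat) : exists j, iter j (up_log 2) n <= 1.
Proof.
elim/ltn_ind: n => n IH; have [n1|n1] := leqP n 1; first by exists 0.
have lt_n : up_log 2 n < n.
  rewrite -(prednK (ltnW n1)) ltnS; apply: up_log_min => //.
  by rewrite -{1}(prednK (ltnW n1)); apply: ltn_expl.
by have [j Hj] := IH _ lt_n; exists j.+1; rewrite iterSr.
Qed.

Definition logstar (n : nat) : nat := ex_minn (logstar_subproof n).

(* Recursive programs over the natural numbers.  A program is the body of one
   recursive function: [Arg i] is its i-th argument, [Call es] the recursive
   call of the function on the values of es. *)
Inductive binop : Set := OAdd | OSub | OMul | ODiv | OMod | OPow | OClog | OLeq.

(* [OClog] is the rounded-up logarithm of v to the base u. *)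
Definition binop_sem (o : binop) (u v : nat) : nat :=
  match o with
  | OAdd => u + v
  | OSub => u - v
  | OMul => u * v
  | ODiv => u %/ v
  | OMod => u %% v
  | OPow => u ^ v
  | OClog => up_log u v
  | OLeq => u <= v
  end.

Inductive rexp : Set :=
| Arg of nat
| Cst of nat
| Bin of binop & rexp & rexp
| Ite of rexp & rexp & rexp
| Call of seq rexp.

(* [eval w body args e v t] : in the program body, with current arguments args,
   e evaluates to v in exactly t unit-cost steps, and no value exceeding w is
   ever computed.  With w polynomial in the input, values fit into words of
   logarithmic length, which keeps the unit-cost measure from hiding work in
   huge integers.  A conditional tests whether its first argument is nonzero
   and evaluates only the selected branch. *)
Inductive eval (w : nat) (body : rexp) : seq nat -> rexp -> nat -> nat -> Prop :=
| eval_Arg args i :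
    eval w body args (Arg i) (nth 0 args i) 1
| eval_Cst args c :
    c <= w -> eval w body args (Cst c) c 1
| eval_Bin args o a b u v s t :
    eval w body args a u s -> eval w body args b v t ->
    binop_sem o u v <= w ->
    eval w body args (Bin o a b) (binop_sem o u v) (s + t + 1)
| eval_Ite args a b c u v s t :
    eval w body args a u s ->
    eval w body args (if u == 0 then c else b) v t ->
    eval w body args (Ite a b c) v (s + t + 1)
| eval_Call args es vs ts v t :
    size vs = size es -> size ts = size es ->
    (forall i, i < size es ->
       eval w body args (nth (Cst 0) es i) (nth 0 vs i) (nth 0 ts i)) ->
    eval w body vs body v t ->
    eval w body args (Call es) v (sumn ts + t + 1).

Definition computes_in (body : rexp) (w : nat) (input : seq nat)
    (v t : nat) : Prop :=
  eval w body input body v t.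

(* Main.v *)
Require Import Defs.
From mathcomp Require Import all_boot all_fingroup zify.

(** An oriented and k-coloured complete bipartite graph is an m x n matrix over an
    alphabet of 2k letters, the letter of an edge being its direction and its
    colour.  If m < n then automorphisms fix the two sides, so the colouring is
    distinguishing iff the matrix is asymmetric: no pair of a row and a
    column permutation other than the identity preserves it
    ([asymmetric_of_distinguishable], [distinguishable_of_asymmetric]).  The case
    m = n forces r = 2 and is settled by a triangular orientation with one
    colour.

    The existence of asymmetric m x n matrices over q letters is monotone in q,
    symmetric in m and n, and, as the columns must be distinct, requires
    n <= q ^ m.  An asymmetric matrix amounts to a set of n words of length m with
    trivial stabilizer in the symmetric group of the positions
    ([has_asymmetricP]), and the complement of such a set has the same stabilizer.
    Hence n can be replaced by q ^ m - n ([has_asymmetricC]).  The rows of the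
    complementary matrix are distinct as well, so m <= q ^ (q ^ m - n), that is,
    n + up_log q m <= q ^ m ([has_asymmetric_up_log]).  In the case of equality,
    complementing and transposing reduces the question from (m, n) to
    (up_log q m, m), and iterating this is the recursive algorithm
    ([decide_body_correct]).

    If n + up_log q m < q ^ m there is an asymmetric matrix
    ([has_asymmetric_exists]).  Complementing and transposing reduces this to
    m <= n <= q ^ m / 2 ([has_asymmetric_half]).  There one uses a binary matrix
    with distinct columns and strictly decreasing row sums, which is built row by
    row ([decreasing_family_exists]), and, if q > 2, additional columns that are
    not binary.

    Finally, k colours give the even number 2k of letters.  Since n > (r - 1) ^ m
    at least r letters are needed, and r + 1 letters always suffice.  So the index
    is r / 2 or (r + 1) / 2, rounded up, according to whether r letters suffice;
    for odd r the two values agree. *)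

Set Implicit Arguments.
Unset Strict Implicit.
Unset Printing Implicit Defensive.

(** * Asymmetric matrices *)

Definition asymmetric (I J : finType) (C : Type) (M : I -> J -> C) : Prop :=
  forall (s : {perm I}) (t : {perm J}),
    (forall i j, M (s i) (t j) = M i j) -> s = 1%g /\ t = 1%g.

Definition has_asymmetric (q m n : nat) : Prop :=
  exists M : 'I_m -> 'I_n -> 'I_q, asymmetric M.

Lemma asymmetric_recolour (I J : finType) (C C' : Type) (f : C -> C')
    (M : I -> J -> C) :
  injective f -> asymmetric M -> asymmetric (fun i j => f (M i j)).
Proof. by move=> inj_f asM s t Mst; apply: asM => i j; apply: inj_f. Qed.

Lemma has_asymmetric_card (C : finType) q m n (M : 'I_m -> 'I_n -> C) :
  #|C| <= q -> asymmetric M -> has_asymmetric q m n.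
Proof.
move=> leCq asM; pose f c := widen_ord leCq (enum_rank c).
exists (fun i j => f (M i j)); apply: asymmetric_recolour asM => x y.
by move/(congr1 val) => /= /val_inj /enum_rank_inj.
Qed.

Lemma has_asymmetric_leq q q' m n :
  q <= q' -> has_asymmetric q m n -> has_asymmetric q' m n.
Proof.
by move=> leqq' [M asM]; apply: has_asymmetric_card asM; rewrite card_ord.
Qed.

Lemma has_asymmetric_tr q m n : has_asymmetric q m n -> has_asymmetric q n m.
Proof.
case=> M asM; exists (fun i j => M j i) => s t Mst.
by have [] := asM t s (fun i j => Mst j i).
Qed.

Lemma has_asymmetric_row q n : n <= q -> has_asymmetric q 1 n.
Proof.
move=> le_nq; exists (fun i j => widen_ord le_nq j) => s t st; split.
  by apply/permP=> i; rewrite perm1 !ord1.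
by apply/permP=> j; rewrite perm1; apply: val_inj; case: (st ord0 j).
Qed.

Section Words.

Variables (I C : finType).
Implicit Types (w : {ffun I -> C}) (X : {set {ffun I -> C}}) (s : {perm I}).

Definition permute s w : {ffun I -> C} := [ffun i => w (s i)].

Lemma permute_inj s : injective (permute s).
Proof.
move=> w w' /ffunP eq_ww'; apply/ffunP=> i.
by have := eq_ww' (s^-1 i)%g; rewrite !ffunE permKV.
Qed.

Definition rigid X : Prop :=
  forall s, (forall w, w \in X -> permute s w \in X) -> s = 1%g.

(** On a finite set an injection into itself is onto, so a permutation that
    maps X into itself maps no other word into X. *)
Lemma permute_stable s X :
  (forall w, w \in X -> permute s w \in X) ->
  forall w, (permute s w \in X) = (w \in X).
Proof.
move=> sX w; have eqX : permute s @: X = X.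
  apply/eqP; rewrite eqEcard card_imset ?leqnn ?andbT; last exact: permute_inj.
  by apply/subsetP=> _ /imsetP[v Xv ->]; apply: sX.
by rewrite -[in LHS]eqX mem_imset //; apply: permute_inj.
Qed.

Lemma rigid_setC X : rigid X -> rigid (~: X).
Proof.
move=> rX s sX; apply: rX => w Xw; have := permute_stable sX w.
by rewrite !inE Xw => /negbFE.
Qed.

(** The number of words of X satisfying P that have the letter c at position i
    is an invariant of the position i, so it suffices that these numbers
    separate the positions. *)
Lemma rigid_degree X (P : pred {ffun I -> C}) (c : C) :
  (forall s w, P (permute s w) = P w) ->
  injective (fun i => #|[set w in X | P w && (w i == c)]|) -> rigid X.
Proof.
move=> invP inj_deg s sX; apply/permP=> i; rewrite perm1; apply: inj_deg.
rewrite -(card_imset _ (@permute_inj s)); apply: eq_card => v.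
apply/imsetP/idP=> [[w]|].
  by rewrite !inE => /and3P[Xw Pw wi] ->; rewrite sX // invP Pw ffunE.
have [w ->] : exists w, v = permute s w.
  exists [ffun j => v (s^-1 j)%g]; apply/ffunP=> j.
  by rewrite !ffunE permK.
rewrite inE permute_stable // invP ffunE => Xw; exists w => //.
by rewrite inE.
Qed.

End Words.

(** The columns of an asymmetric matrix are distinct, as two equal columns could
    be exchanged; conversely, once the columns are distinct a permutation of
    the rows determines the permutation of the columns. *)
Lemma has_asymmetricP q m n :
  has_asymmetric q m n <->
  exists2 X : {set {ffun 'I_m -> 'I_q}}, rigid X & #|X| = n.
Proof.
split=> [[M asM]|[X rX cX]].
  pose col j := [ffun i => M i j].
  have inj_col : injective col.
    move=> j j' /ffunP eqjj'; case: (asM 1%g (tperm j j')) => [i k|_].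
      rewrite perm1; have := eqjj' i; rewrite !ffunE.
      by case: tpermP => [->|->|].
    by move/permP/(_ j); rewrite tpermL perm1.
  exists [set col j | j : 'I_n]; last by rewrite card_imset // card_ord.
  move=> s sX.
  have /fin_all_exists[t tE] j : exists k, permute s (col j) = col k.
    have /imsetP[k _ ->] := sX _ (imset_f col (erefl true : j \in predT)).
    by exists k.
  have inj_t : injective t.
    by move=> j k eqt; apply/inj_col/(@permute_inj _ _ s); rewrite !tE eqt.
  case: (asM s (perm inj_t)^-1%g) => // i j.
  have /ffunP/(_ i) := tE ((perm inj_t)^-1%g j).
  by rewrite !ffunE => ->; congr (M _ _); rewrite -(permE inj_t) permKV.
pose col (j : 'I_n) := enum_val (cast_ord (esym cX) j).
have inj_col : injective col by move=> j k /enum_val_inj /cast_ord_inj.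
have colP w : w \in X -> exists j, w = col j.
  move=> Xw; exists (cast_ord cX (enum_rank_in Xw w)).
  by rewrite /col cast_ordK enum_rankK_in.
exists (fun i j => col j i) => s t Mst.
have st j : permute s (col (t j)) = col j.
  by apply/ffunP=> i; rewrite ffunE Mst.
have s1 : s = 1%g.
  apply: rX => _ /colP[j ->].
  by rewrite -{1}[j](permKV t) st; apply: enum_valP.
split=> //; apply/permP=> j; rewrite perm1; apply: inj_col; rewrite -(st j).
by apply/ffunP=> i; rewrite ffunE s1 perm1.
Qed.

Lemma has_asymmetric_max q m n : has_asymmetric q m n -> n <= q ^ m.
Proof.
case/has_asymmetricP=> X _ <-.
by apply: leq_trans (max_card _) _; rewrite card_ffun !card_ord.
Qed.

(** Pass to the complement of the set of columns in the set of all words. *)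
Lemma has_asymmetricC q m n :
  n <= q ^ m -> has_asymmetric q m (q ^ m - n) <-> has_asymmetric q m n.
Proof.
move=> le_n; have imp k l : k + l = q ^ m ->
    has_asymmetric q m k -> has_asymmetric q m l.
  move=> eqkl /has_asymmetricP[X rX cX]; apply/has_asymmetricP.
  exists (~: X); first exact: rigid_setC.
  by apply/eqP; rewrite -(eqn_add2l #|X|) cardsC cX eqkl card_ffun !card_ord.
by split; apply: imp; rewrite ?subnK // subnKC.
Qed.

(** The rows of the complementary matrix must be distinct too. *)
Lemma has_asymmetric_up_log q m n :
  1 < q -> has_asymmetric q m n -> n + up_log q m <= q ^ m.
Proof.
move=> q1 asn; have le_n := has_asymmetric_max asn.
move/(has_asymmetricC le_n)/has_asymmetric_tr/has_asymmetric_max: asn => le_m.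
by rewrite -leq_subRL //; apply: up_log_min.
Qed.

(** The complementary matrix has as many columns as the logarithm of its number
    of rows; transposed, it is an instance of the same question of
    logarithmic size. *)
Lemma has_asymmetric_swap q m n :
  n + up_log q m = q ^ m ->
  has_asymmetric q m n <-> has_asymmetric q (up_log q m) m.
Proof.
move=> eqn; have le_n : n <= q ^ m by rewrite -eqn leq_addr.
have -> : up_log q m = q ^ m - n by rewrite -eqn addKn.
split=> [/(has_asymmetricC le_n)/has_asymmetric_tr //|asm].
exact/(has_asymmetricC le_n)/has_asymmetric_tr.
Qed.

(** * Binary matrices with decreasing row sums *)

(** A seq of 0/1 words of equal length lists the columns of a binary matrix; the
    degree of i is the number of ones in its row i. *)
Definition degree (i : nat) (X : seq bitseq) : nat :=
  count (fun w => nth false w i) X.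

Definition decreasing_degrees (a : nat) (X : seq bitseq) : Prop :=
  [/\ uniq X, all (fun w => size w == a) X
    & forall i j, i < j < a -> degree j X < degree i X].

Fixpoint words (a : nat) : seq bitseq :=
  if a is a'.+1 then map (cons true) (words a') ++ map (cons false) (words a')
  else [:: [::]].

Lemma cons_inj (b : bool) : injective (cons b).
Proof. by move=> v w []. Qed.

Lemma mem_map_cons (b c : bool) (w : bitseq) (X : seq bitseq) :
  (c :: w \in map (cons b) X) = (c == b) && (w \in X).
Proof.
apply/mapP/andP=> [[v Xv [-> ->]]|[/eqP-> Xw]]; first by rewrite eqxx.
by exists w.
Qed.

Lemma mem_words a w : (w \in words a) = (size w == a).
Proof.
elim: a w => [|a IH] [|c w] //=.
  by rewrite mem_cat; apply/negP=> /orP[] /mapP[w _].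
by rewrite mem_cat !mem_map_cons IH eqSS; case: c; rewrite ?orbF.
Qed.

Lemma uniq_cat_cons (X Y : seq bitseq) :
  uniq (map (cons true) X ++ map (cons false) Y) = uniq X && uniq Y.
Proof.
rewrite cat_uniq !map_inj_uniq; try exact: cons_inj.
suff -> : has (mem (map (cons true) X)) (map (cons false) Y) = false by [].
by apply/hasP=> -[_ /mapP[w _ ->]] /=; rewrite mem_map_cons.
Qed.

Lemma uniq_words a : uniq (words a).
Proof. by elim: a => //= a IH; rewrite uniq_cat_cons IH. Qed.

Lemma size_words a : size (words a) = 2 ^ a.
Proof. by elim: a => //= a IH; rewrite size_cat !size_map IH expnS; lia. Qed.

Lemma degree0_cat_cons X Y :
  degree 0 (map (cons true) X ++ map (cons false) Y) = size X.
Proof.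
rewrite /degree count_cat !count_map /preim /= count_pred0 addn0.
exact: count_predT.
Qed.

Lemma degreeS_cat_cons i X Y :
  degree i.+1 (map (cons true) X ++ map (cons false) Y) =
  degree i X + degree i Y.
Proof. by rewrite /degree count_cat !count_map. Qed.

Lemma degree_words a i : i < a -> (degree i (words a)).*2 = 2 ^ a.
Proof.
elim: a i => // a IH [_|i lti].
  by rewrite degree0_cat_cons size_words expnS mul2n.
by rewrite degreeS_cat_cons doubleD IH // expnS mul2n addnn.
Qed.

(** Complementing a family reverses the order of its degrees; exchanging the two
    letters as well restores it. *)
Definition dual (a : nat) (X : seq bitseq) : seq bitseq :=
  map (map negb) [seq w <- words a | w \notin X].

Lemma perm_words_compl (a : nat) (X : seq bitseq) :
  uniq X -> all (fun w => size w == a) X ->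
  perm_eq (words a) (X ++ [seq w <- words a | w \notin X]).
Proof.
move=> uX sX; apply: uniq_perm; first exact: uniq_words.
  rewrite cat_uniq uX filter_uniq ?uniq_words // andbT; apply/hasP=> -[w].
  by rewrite mem_filter => /andP[/negP Xw _] /Xw.
move=> w; rewrite mem_cat mem_filter mem_words.
by have [/(allP sX)->|] := boolP (w \in X).
Qed.

Lemma size_dual (a : nat) (X : seq bitseq) :
  uniq X -> all (fun w => size w == a) X -> size X + size (dual a X) = 2 ^ a.
Proof.
move=> uX sX; have /perm_size := perm_words_compl uX sX.
by rewrite size_words size_cat size_map.
Qed.

(** Each of the 2 ^ a - |X| words outside X contributes to the degree of i in the
    dual exactly when its letter at i is 0, and half of all words have a 0
    there.  The equation is doubled to avoid the half. *)
Lemma degree_dual (a : nat) (X : seq bitseq) (i : nat) :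
  uniq X -> all (fun w => size w == a) X -> i < a ->
  (degree i (dual a X) + size X).*2 = 2 ^ a + (degree i X).*2.
Proof.
move=> uX sX lti; have /seq.permP eq_count := perm_words_compl uX sX.
set Y := filter _ _ in eq_count.
pose p (w : bitseq) := ~~ nth false w i.
have -> : degree i (dual a X) = count p Y.
  rewrite /degree count_map; apply: eq_in_count => w /=.
  rewrite mem_filter mem_words => /andP[_ /eqP sw].
  by rewrite (nth_map false) ?sw.
have countN V : degree i V + count p V = size V by exact: count_predC.
have eqY : count p (words a) = count p X + count p Y.
  by rewrite eq_count count_cat.
have := degree_words lti; have := countN X; have := countN (words a).
by rewrite size_words eqY; lia.
Qed.

Lemma decreasing_dual a X :
  decreasing_degrees a X -> decreasing_degrees a (dual a X).
Proof.
case=> uX sX decX; split.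
- rewrite map_inj_uniq ?filter_uniq ?uniq_words //.
  exact: (inj_map negb_inj).
- apply/allP=> _ /mapP[w + ->].
  by rewrite mem_filter mem_words size_map => /andP[].
move=> i j /andP[ltij ltj]; have lti := ltn_trans ltij ltj.
have := decX i j; rewrite ltij ltj => /(_ isT).
by have := degree_dual uX sX lti; have := degree_dual uX sX ltj; lia.
Qed.

(** The zero word and the first x unit vectors.  Their degrees are 1 below x
    and 0 from x on, so adding them to a family with decreasing degrees keeps the degrees
    decreasing, which makes them a means of adjusting the size of a family. *)
Definition unit_words (a x : nat) : seq bitseq :=
  nseq a false :: [seq mkseq (eq_op^~ k) a | k <- iota 0 x].

Lemma degree_unit_words a x i : i < a -> degree i (unit_words a x) = (i < x).
Proof.
move=> lti; rewrite /degree /= nth_nseq if_same add0n count_map.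
have /eq_count-> : preim (fun k => mkseq (eq_op^~ k) a)
    (fun w => nth false w i) =1 pred1 i.
  by move=> k /=; rewrite nth_mkseq // eq_sym.
by rewrite count_uniq_mem ?iota_uniq // mem_iota.
Qed.

Lemma uniq_unit_words a x : x <= a -> uniq (unit_words a x).
Proof.
move=> lexa; rewrite /= map_inj_in_uniq ?iota_uniq ?andbT.
  apply/mapP=> -[k]; rewrite mem_iota => /= ltk /(congr1 (nth false ^~ k)).
  by rewrite nth_nseq if_same nth_mkseq ?eqxx //; apply: leq_trans ltk lexa.
move=> k l; rewrite !mem_iota /= => ltk _ /(congr1 (nth false ^~ k)).
have ltka : k < a by apply: leq_trans ltk lexa.
by rewrite !nth_mkseq // eqxx => /esym/eqP.
Qed.

(** The new first row marks the words that come from X.  Its degree is |X|, and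
    the hypothesis says that the unit words do not lift another row up to it; the
    presence of the zero word prevents the new row from being full. *)
Lemma decreasing_step a X x :
  decreasing_degrees a X -> x <= a ->
  (forall i, i < a -> degree i X + (0 < x) < size X) ->
  let Y := map (cons true) X ++ map (cons false) (unit_words a x) in
  [/\ decreasing_degrees a.+1 Y, size Y = size X + x.+1
    & forall i, i < a.+1 -> degree i Y < size Y].
Proof.
move=> [uX sX decX] lexa bndX Y.
have sY : size Y = size X + x.+1.
  by rewrite size_cat !size_map /= size_map size_iota.
have degY i : i < a -> degree i.+1 Y = degree i X + (i < x).
  by move=> lti; rewrite degreeS_cat_cons degree_unit_words.
have deg0 : degree 0 Y = size X by apply: degree0_cat_cons.
split=> //; last first.
  case=> [|i] lti; first by rewrite deg0 sY; lia.
  by have := bndX i lti; rewrite degY // sY; lia.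
split.
- by rewrite uniq_cat_cons uX uniq_unit_words.
- rewrite all_cat !all_map; apply/andP; split=> //.
  rewrite /= size_nseq eqxx all_map.
  by apply/allP=> k _ /=; rewrite size_mkseq.
case=> [|i] [|j] // /andP[ltij ltj].
  by have := bndX j ltj; rewrite degY // deg0; lia.
have lti : i < a by apply: ltn_trans ltij ltj.
by have := decX i j (introT andP (conj ltij ltj)); rewrite !degY //; lia.
Qed.

(** Induction on a, by the previous step.  If b <= 2 ^ (a - 2) + 1, the induction
    hypothesis provides the family for a - 1; its degrees are below its size
    because no row is full.  For larger b the dual of such a family is used: its
    degrees are at most 2 ^ (a - 2), as only so many words of length a - 1 have
    a 1 at a given position.  A dual has at most 2 ^ (a - 1) - (a - 1) words, and
    the last few values of b are reached by adding unit words, for which there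
    is room between the degrees and the size if a > 4.  The exceptions with
    a <= 4 are listed. *)
Lemma decreasing_family_exists a b :
  a <= b -> b.*2 <= 2 ^ a ->
  exists X, [/\ decreasing_degrees a X, size X = b
              & forall i, i < a -> degree i X < b].
Proof.
elim: a b => [|a IH] b leab leb.
  have -> : b = 0 by move: leb; rewrite expn0; lia.
  by exists [::]; split=> //; split=> // i j; rewrite ltn0 andbF.
have dualP c : a <= c -> c.*2 < 2 ^ a ->
    exists X, [/\ decreasing_degrees a X, size X + c = 2 ^ a
                & forall i, i < a -> (degree i X).*2 <= 2 ^ a].
  move=> leac ltc; have [X [dX sX bX]] := IH c leac (ltnW ltc).
  have [uX szX _] := dX; exists (dual a X); split.
  - exact: decreasing_dual.
  - by have := size_dual uX szX; rewrite sX; lia.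
  by move=> i lti; have := degree_dual uX szX lti; have := bX i lti; lia.
have concl X x : decreasing_degrees a X -> x <= a -> size X + x.+1 = b ->
    (forall i, i < a -> degree i X + (0 < x) < size X) ->
    exists Y, [/\ decreasing_degrees a.+1 Y, size Y = b
                & forall i, i < a.+1 -> degree i Y < b].
  move=> dX lexa <- bX; have [dY <- bY] := decreasing_step dX lexa bX.
  by eexists; split; [exact: dY | | exact: bY].
have pow : 2 ^ a.+1 = (2 ^ a).*2 by rewrite expnS mul2n.
have [small|big] := leqP (b.-1).*2 (2 ^ a).
  have [|X [dX sX bX]] := IH b.-1 _ small; first lia.
  by apply: (concl X 0) => // [|i lti]; [lia | rewrite sX addn0; apply: bX].
have [mid|large] := leqP (b.-1 + a) (2 ^ a).
  have [||X [dX sX bX]] := dualP (2 ^ a - b.-1); try lia.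
  by apply: (concl X 0) => // [|i lti]; [lia | have := bX i lti; lia].
(* The dual of a smallest family, together with unit words. *)
have [a4|] := leqP 4 a.
  have exp_a : 2 * a < 2 ^ a /\ 2 * a + 2 < 2 ^ a.
    by elim: (a) a4 => // k IHk; rewrite leq_eqVlt => /orP[/eqP<-//|/IHk];
      rewrite expnS; lia.
  have [||X [dX sX bX]] := dualP a; try lia.
  by apply: (concl X (b - size X).-1) => // [||i lti];
    [lia | lia | have := bX i lti; lia].
move=> a4.
(* The three pairs (a + 1, b) left are (3, 4), (4, 7) and (4, 8). *)
have check X : uniq X -> all (fun w => size w == a.+1) X ->
    all (fun j => all (fun i => degree j X < degree i X) (iota 0 j))
      (iota 0 a.+1) ->
    all (fun i => degree i X < size X) (iota 0 a.+1) -> size X = b ->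
    exists Y, [/\ decreasing_degrees a.+1 Y, size Y = b
                & forall i, i < a.+1 -> degree i Y < b].
  move=> uX szX /allP dX /allP bX eqb; exists X; split=> //; last first.
    by move=> i lti; rewrite -eqb; apply: bX; rewrite mem_iota.
  split=> // i j /andP[ltij ltj]; have /dX/allP : j \in iota 0 a.+1.
    by rewrite mem_iota.
  by apply; rewrite mem_iota.
pose bits := map (map (fun d => d == 1)).
have [[ea eb]|[[ea eb]|[ea eb]]] :
    (a = 2 /\ b = 4) \/ (a = 3 /\ b = 7) \/ (a = 3 /\ b = 8).
- have : [|| a == 0, a == 1, a == 2 | a == 3] by lia.
  by case/or4P=> /eqP ea; move: leb large big; rewrite ea => /=; lia.
- apply: (check (bits
    [:: [:: 1; 1; 1]; [:: 1; 1; 0]; [:: 1; 0; 0]; [:: 0; 0; 0]]));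
    by rewrite ?ea ?eb.
- apply: (check (bits
    [:: [:: 1; 1; 1; 1]; [:: 1; 1; 1; 0]; [:: 1; 1; 0; 1]; [:: 1; 1; 0; 0];
        [:: 1; 0; 1; 1]; [:: 1; 0; 1; 0]; [:: 0; 1; 0; 0]]));
    by rewrite ?ea ?eb.
apply: (check (bits
  [:: [:: 1; 1; 1; 1]; [:: 1; 1; 1; 0]; [:: 1; 1; 0; 1]; [:: 1; 1; 0; 0];
      [:: 1; 0; 1; 1]; [:: 1; 0; 1; 0]; [:: 1; 0; 0; 0]; [:: 0; 1; 0; 0]]));
  by rewrite ?ea ?eb.
Qed.

(** * Existence of asymmetric matrices *)

Lemma card_set_seq (T : finType) (s : seq T) (p : pred T) :
  uniq s -> #|[set x in s | p x]| = count p s.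
Proof.
move=> us; rewrite -size_filter -(card_uniqP (filter_uniq p us)).
by apply: eq_card => x; rewrite inE mem_filter andbC.
Qed.

Lemma exists_subset_card (T : finType) (A : {set T}) k :
  k <= #|A| -> exists2 B : {set T}, B \subset A & #|B| = k.
Proof.
case/card_geqP=> s [us <- sA]; exists [set x in s].
  by apply/subsetP=> x; rewrite inE => /sA.
by rewrite cardsE; apply/card_uniqP.
Qed.

Lemma leq_pow2_pow q a : 2 < q -> 0 < a -> (2 ^ a).*2 <= q ^ a + a.
Proof.
move=> q2; case: a => [|[|a]] // _; first by rewrite !expn1; lia.
have le3q : 3 ^ a.+2 <= q ^ a.+2 by rewrite leq_exp2r.
suff : (2 ^ a.+2).*2 <= 3 ^ a.+2 by lia.
by elim: (a) => // k IH; rewrite ![_ ^ k.+3]expnS; lia.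
Qed.

(** The columns are a binary family with decreasing degrees and arbitrary words
    that are not binary.  Being binary is invariant under permutations of the
    positions, so the degrees are counted on the binary columns alone.  If
    b exceeds 2 ^ a / 2 then q > 2, and there are enough words that are not
    binary to complete a binary family of size a. *)
Lemma has_asymmetric_half q a b :
  1 < q -> a <= b -> b.*2 <= q ^ a -> has_asymmetric q a b.
Proof.
case: q => [|[|q]] // _ leab leb.
pose one : 'I_q.+2 := Ordinal (isT : 1 < q.+2).
pose emb (w : bitseq) : {ffun 'I_a -> 'I_q.+2} :=
  [ffun i : 'I_a => if nth false w i then one else ord0].
pose binary (v : {ffun 'I_a -> 'I_q.+2}) := [forall i, v i < 2].
(* b0 is the number of binary columns. *)
have [b0 [leab0 leb0 leb0b leY]] : exists b0,
    [/\ a <= b0, b0.*2 <= 2 ^ a, b0 <= b & b - b0 <= q.+2 ^ a - 2 ^ a].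
  have [small|big] := leqP b.*2 (2 ^ a).
    by exists b; rewrite subnn.
  have a_gt0 : 0 < a.
    by case: (a) leb big => //; rewrite !expn0; lia.
  have q_gt0 : 2 < q.+2.
    by case: (q) leb => // leb; rewrite ltnNge leb in big.
  exists a; split=> //; last by have := leq_pow2_pow q_gt0 a_gt0; lia.
  by case: (a) a_gt0 => // k _; elim: k => // k; rewrite [_ ^ k.+2]expnS; lia.
have [X [[uX szX decX] sX _]] := decreasing_family_exists leab0 leb0.
have inj_emb : {in X &, injective emb}.
  move=> w v /(allP szX)/eqP sw /(allP szX)/eqP sv /ffunP eqwv.
  apply: (@eq_from_nth _ false); rewrite sw ?sv // => i lti.
  have := eqwv (Ordinal lti); rewrite !ffunE /=.
  by case: nth; case: nth.
have uE : uniq (map emb X) by rewrite map_inj_in_uniq.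
pose E := [set v in map emb X].
have binE v : v \in E -> binary v.
  rewrite inE => /mapP[w _ ->]; apply/forallP=> i.
  by rewrite ffunE; case: ifP.
have cardB : #|[set v | binary v]| <= 2 ^ a.
  pose g (f : {ffun 'I_a -> bool}) : {ffun 'I_a -> 'I_q.+2} :=
    [ffun i => if f i then one else ord0].
  have <- : #|{ffun 'I_a -> bool}| = 2 ^ a.
    by rewrite card_ffun card_bool card_ord.
  rewrite -cardsT; apply: leq_trans (leq_imset_card g _); apply: subset_leq_card.
  apply/subsetP=> v; rewrite inE => /forallP bv.
  apply/imsetP; exists [ffun i => v i == one] => //; apply/ffunP=> i.
  rewrite !ffunE; case: eqP => // /eqP neq; apply: val_inj => /=.
  by move: (bv i) neq; rewrite -val_eqE /=; lia.
have [|Y YB cY] := @exists_subset_card _ (~: [set v | binary v]) (b - b0).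
  rewrite cardsCs setCK card_ffun !card_ord; apply: leq_trans leY _.
  exact: leq_sub2l.
have binY v : v \in Y -> ~~ binary v by move/(subsetP YB); rewrite !inE.
apply/has_asymmetricP; exists (E :|: Y); last first.
  have /eqP disj : E :&: Y == set0.
    apply/eqP/setP=> v; rewrite in_setI in_set0; apply/andP=> -[/binE bv].
    by move/binY; rewrite bv.
  rewrite cardsU disj cards0 subn0 cY cardsE (card_uniqP uE) size_map sX.
  exact: subnKC.
apply: (@rigid_degree _ _ _ binary one) => [s v|].
  apply/forallP/forallP=> bv i; last by rewrite ffunE.
  by have := bv (s^-1 i)%g; rewrite ffunE permKV.
have degE i : #|[set v in E :|: Y | binary v && (v i == one)]| = degree i X.
  transitivity (count (fun v : {ffun _ -> _} => v i == one) (map emb X)).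
    rewrite -card_set_seq //; apply: eq_card => v; rewrite !inE.
    have [Ev|nEv] /= := boolP (v \in map emb X).
      by rewrite binE // inE.
    by have [/binY/negPf->|] := boolP (v \in Y).
  rewrite count_map; apply: eq_count => w /=; rewrite ffunE.
  by case: nth.
move=> i j eqij; have {eqij} eqij : degree i X = degree j X.
  by rewrite -(degE i) -(degE j).
apply: val_inj; case: (ltngtP i j) => // lt_ij.
  by have := decX i j; rewrite lt_ij ltn_ord eqij ltnn => /(_ isT).
by have := decX j i; rewrite lt_ij ltn_ord eqij ltnn => /(_ isT).
Qed.

(** If more than half of all words are used, take the complement, of N columns.
    If N < m, exchange rows and columns: as m <= q ^ (N - 1), at most half of the
    words of length N are needed. *)
Lemma has_asymmetric_exists q m n :
  1 < q -> m <= n -> n + up_log q m + 1 <= q ^ m -> has_asymmetric q m n.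
Proof.
move=> q1 lemn len; have [small|big] := leqP n.*2 (q ^ m).
  exact: has_asymmetric_half.
have le_n : n <= q ^ m by lia.
apply/(has_asymmetricC le_n); set N := q ^ m - n.
have ltN : up_log q m < N by rewrite /N; lia.
have [leN|ltNm] := leqP m N; first by apply: has_asymmetric_half => //; lia.
apply/has_asymmetric_tr/has_asymmetric_half => //; first exact: ltnW.
rewrite -(prednK (leq_ltn_trans (leq0n _) ltN)) expnS -mul2n.
apply: leq_mul => //.
apply: leq_trans (up_logP m q1) _; rewrite leq_exp2l //; lia.
Qed.

Lemma up_log_lt q m : 1 < q -> 0 < m -> up_log q m < m.
Proof.
move=> q1 m_gt0; rewrite -[ltnRHS](prednK m_gt0) ltnS; apply: up_log_min => //.
by rewrite -{1}(prednK m_gt0); apply: ltn_expl.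
Qed.

(** One letter more than r makes q ^ m exceed n by at least m, which is more than
    the logarithm of m. *)
Lemma has_asymmetric_big q r m n :
  0 < r < q -> 0 < m <= n -> n <= r ^ m -> has_asymmetric q m n.
Proof.
move=> /andP[r_gt0 ltrq] /andP[m_gt0 lemn] len.
have q1 : 1 < q by apply: leq_ltn_trans ltrq.
apply: has_asymmetric_exists => //.
have leq_q : r.+1 ^ m <= q ^ m by rewrite leq_exp2r.
have := up_log_lt q1 m_gt0.
suff : r ^ m + m <= r.+1 ^ m by lia.
elim: (m) => // k IH; have := expn_gt0 r k; rewrite r_gt0 /=.
by rewrite !expnS; nia.
Qed.

(** * Orientations of complete bipartite graphs *)

(** Minimizing over orientations and over colourings can be done at once, so the
    index of a single orientation need not be computed. *)
Definition distinguishable (T : finType) (e : rel T) (k : nat) : Prop :=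
  exists d : rel T,
    orientation e d /\ exists c : T -> T -> 'I_k, distinguishing d c.

Lemma OD_minus_least (T : finType) (e : rel T) k :
  0 < k -> distinguishable e k ->
  (forall j, 0 < j -> distinguishable e j -> k <= j) -> OD_minus e k.
Proof.
move=> k_gt0 [d [de [c dc]]] min_k; split.
  exists d; split=> //; split; first by split=> //; exists c.
  by move=> j [j_gt0 dj]; apply: min_k => //; exists d.
by move=> j [d' [de' [[j_gt0 dj] _]]]; apply: min_k => //; exists d'.
Qed.

(** The letter of an edge is its direction together with its colour. *)
Lemma asymmetric_of_distinguishable m n k :
  distinguishable (complete_bipartite m n) k -> has_asymmetric k.*2 m n.
Proof.
case=> d [[sub_d tour_d] [c dc]].
pose M i j : bool * 'I_k := (d (inl i) (inr j),
  if d (inl i) (inr j) then c (inl i) (inr j) else c (inr j) (inl i)).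
apply: (@has_asymmetric_card _ _ _ _ M).
  by rewrite card_prod card_bool card_ord mul2n.
move=> s t Mst.
pose f (x : 'I_m + 'I_n) : 'I_m + 'I_n :=
  match x with inl i => inl (s i) | inr j => inr (t j) end.
have inj_f : injective f by case=> x [] y [] // /perm_inj ->.
have dN i j : d (inr j) (inl i) = ~~ d (inl i) (inr j).
  have := tour_d (inl i) (inr j) isT.
  by case: (d (inl i) _); case: (d (inr j) _).
have dll i i' : d (inl i) (inl i') = false.
  by apply/negP=> /sub_d.
have drr j j' : d (inr j) (inr j') = false.
  by apply/negP=> /sub_d.
have d_st i j : d (inl (s i)) (inr (t j)) = d (inl i) (inr j).
  by case: (Mst i j).
have f1 : perm inj_f = 1%g.
  apply: dc => [[i|j] [i'|j']|[i|j] [i'|j']]; rewrite !permE /= ?dll ?drr //.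
  - by rewrite !dN d_st.
  - by move=> dij; case: (Mst i j'); rewrite d_st dij.
  by rewrite dN => /negPf dij; case: (Mst i' j); rewrite d_st dij.
split; apply/permP=> i; rewrite perm1.
  by have /permP/(_ (inl i)) := f1; rewrite permE perm1 => -[].
by have /permP/(_ (inr i)) := f1; rewrite permE perm1 => -[].
Qed.

Section MatrixToDigraph.

Variables (m n k : nat) (M : 'I_m -> 'I_n -> bool * 'I_k).

Definition matrix_arcs : rel ('I_m + 'I_n) := fun x y =>
  match x, y with
  | inl i, inr j => (M i j).1
  | inr j, inl i => ~~ (M i j).1
  | _, _ => false
  end.

Lemma orientation_matrix_arcs :
  orientation (complete_bipartite m n) matrix_arcs.
Proof. by split; case=> x [] y //= _; case: (M _ _).1. Qed.

Definition matrix_colours (c0 : 'I_k) (x y : 'I_m + 'I_n) : 'I_k :=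
  match x, y with
  | inl i, inr j | inr j, inl i => (M i j).2
  | _, _ => c0
  end.

Lemma automorphism_adjacent (s : {perm 'I_m + 'I_n}) x y :
  automorphism matrix_arcs s ->
  complete_bipartite m n (s x) (s y) = complete_bipartite m n x y.
Proof.
move=> aut_s; have adj u v : complete_bipartite m n u v =
    matrix_arcs u v || matrix_arcs v u.
  by case: u v => u [] v //=; case: (M _ _).1.
by rewrite !adj !aut_s.
Qed.

(** An automorphism that fixes the two sides is a pair of permutations, of the
    rows and of the columns; as the graph is connected, one vertex is enough
    to see that the sides are fixed. *)
Lemma distinguishing_matrix (c0 : 'I_k) :
  0 < n -> asymmetric M ->
  (forall s, automorphism matrix_arcs s -> exists i i', s (inl i) = inl i') ->
  distinguishing matrix_arcs (matrix_colours c0).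
Proof.
move=> n_gt0 asM side s aut_s col_s; have [i0 [i1 s0]] := side s aut_s.
have adj x y := automorphism_adjacent x y aut_s.
have /fin_all_exists[t tE] j : exists j', s (inr j) = inr j'.
  have := adj (inl i0) (inr j); rewrite s0.
  by case: (s (inr j)) => // j' _; exists j'.
have /fin_all_exists[u uE] i : exists i', s (inl i) = inl i'.
  have := adj (inr (Ordinal n_gt0)) (inl i); rewrite tE.
  by case: (s (inl i)) => // i' _; exists i'.
have inj_t : injective t.
  by move=> j j' eqj; have /perm_inj[] : s (inr j) = s (inr j') by rewrite !tE eqj.
have inj_u : injective u.
  by move=> i i' eqi; have /perm_inj[] : s (inl i) = s (inl i') by rewrite !uE eqi.
have [i j|/permP u1 /permP t1] := asM (perm inj_u) (perm inj_t).
  rewrite !permE; have := aut_s (inl i) (inr j); rewrite uE tE /= => M1.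
  have M2 : (M (u i) (t j)).2 = (M i j).2.
    have := col_s (inl i) (inr j); have := col_s (inr j) (inl i).
    by rewrite !uE !tE /=; case: (M i j).1 => /=; auto.
  by move: M1 M2; case: (M _ _) => x y; case: (M i j) => x' y' /= -> ->.
apply/permP=> -[i|j]; rewrite perm1 ?uE ?tE.
  by have := u1 i; rewrite permE perm1 => ->.
by have := t1 j; rewrite permE perm1 => ->.
Qed.

End MatrixToDigraph.

(** As m < n, an automorphism cannot send a vertex of the left side to the right:
    its n neighbours would be sent injectively to m vertices. *)
Lemma distinguishable_of_asymmetric m n k :
  0 < m < n -> has_asymmetric k.*2 m n ->
  distinguishable (complete_bipartite m n) k.
Proof.
move=> /andP[m_gt0 ltmn] [M0 asM0].
have card_C : #|'I_k.*2| = #|{: bool * 'I_k}|.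
  by rewrite card_prod card_bool !card_ord mul2n.
pose f (x : 'I_k.*2) : bool * 'I_k := enum_val (cast_ord card_C (enum_rank x)).
have inj_f : injective f.
  by move=> x y /enum_val_inj/cast_ord_inj/enum_rank_inj.
pose M i j := f (M0 i j).
have asM : asymmetric M by apply: asymmetric_recolour asM0.
have n_gt0 : 0 < n by apply: leq_ltn_trans ltmn.
pose c0 := (M (Ordinal m_gt0) (Ordinal n_gt0)).2.
exists (matrix_arcs M); split; first exact: orientation_matrix_arcs.
exists (matrix_colours M c0); apply: distinguishing_matrix => // s aut_s.
exists (Ordinal m_gt0); case s0: (s _) => [i1|j1]; first by exists i1.
have /fin_all_exists[t tE] j : exists i, s (inr j) = inl i.
  have := automorphism_adjacent (inl (Ordinal m_gt0)) (inr j) aut_s.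
  by rewrite s0; case: (s (inr j)) => // i _; exists i.
have /leq_card : injective t.
  by move=> j j' eqj; have /perm_inj[] : s (inr j) = s (inr j') by rewrite !tE eqj.
by rewrite !card_ord leqNgt ltmn.
Qed.

(** The numbers of true entries in the rows are pairwise distinct. *)
Lemma asymmetric_triangular n (C : Type) (c : C) :
  asymmetric (fun i j : 'I_n => (i <= j, c)).
Proof.
move=> s t st; have {}st i j : (s i <= t j) = (i <= j) by case: (st i j).
have s1 : s = 1%g.
  apply/permP=> i; rewrite perm1; apply: val_inj.
  pose up k := #|[set j : 'I_n | k <= j]|.
  have eq_up : up (s i) = up i.
    rewrite /up -[RHS](card_imset _ (@perm_inj _ t)); apply: eq_card => j.
    rewrite inE -[j](permKV t) st mem_imset ?inE //.
    exact: perm_inj.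
  have lt_up (k l : 'I_n) : k < l -> up l < up k.
    move=> ltkl; apply: proper_card; apply/properP; split.
      by apply/subsetP=> j; rewrite !inE; apply: leq_trans; apply: ltnW.
    by exists k; rewrite !inE // -ltnNge.
  by case: (ltngtP (s i) i) => // /lt_up; rewrite eq_up ltnn.
split=> //; apply/permP=> j; rewrite perm1; apply/val_inj/eqP.
have := st j j; have := st (t j) j; rewrite s1 !perm1 !leqnn => le_tj le_jt.
by rewrite eqn_leq -le_tj le_jt.
Qed.

(** When the two sides have equal size, an exchange of them has to be excluded.
    In the triangular orientation the first vertex of the left side is a source,
    and no vertex of the right side is one. *)
Lemma distinguishable_square n :
  0 < n -> distinguishable (complete_bipartite n n) 1.
Proof.
move=> n_gt0; pose M (i j : 'I_n) : bool * 'I_1 := (i <= j, ord0).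
exists (matrix_arcs M); split; first exact: orientation_matrix_arcs.
exists (matrix_colours M ord0).
apply: distinguishing_matrix => // [|s aut_s]; first exact: asymmetric_triangular.
exists (Ordinal n_gt0); case s0: (s _) => [i1|j1]; first by exists i1.
have := aut_s (s^-1 (inl (Ordinal n_gt0)))%g (inl (Ordinal n_gt0)).
by rewrite permKV s0 /=; case: (s^-1 _)%g.
Qed.

Section Index.

Variables m n r : nat.
Hypotheses (m_ge2 : 2 <= m) (le_mn : m <= n) (r_ge2 : 2 <= r).
Hypotheses (lt_n : (r - 1) ^ m < n) (le_n : n <= r ^ m).

(** The case m = n, in which the correspondence with matrices may fail, only occurs
    for r = 2, where one colour suffices. *)
Lemma square_parameters : m = n -> r = 2 /\ n.*2 <= 2 ^ n.
Proof.
move=> eq_mn; split; last first.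
  rewrite -eq_mn; case: (m) m_ge2 => [|[|k]] // _.
  by elim: k => // k IH; rewrite expnS; lia.
apply/eqP; rewrite eqn_leq r_ge2 andbT leqNgt; apply/negP=> r3.
have : 2 ^ m <= (r - 1) ^ m by rewrite leq_exp2r; lia.
by have := ltn_expl m (isT : 1 < 2); lia.
Qed.

(** Fewer than r / 2 colours give at most r - 1 letters, too few for n distinct
    columns. *)
Lemma OD_minus_asymmetric :
  has_asymmetric r m n -> OD_minus (complete_bipartite m n) (uphalf r).
Proof.
move=> as_r; apply: OD_minus_least; first lia.
  case: (ltngtP m n) le_mn => // [lt_mn|eq_mn] _.
    apply: distinguishable_of_asymmetric; first by rewrite lt_mn andbT; lia.
    by apply: has_asymmetric_leq as_r; lia.
  have [-> _] := square_parameters eq_mn.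
  by rewrite -eq_mn; apply: distinguishable_square; lia.
move=> j j_gt0 /asymmetric_of_distinguishable/has_asymmetric_max le_nj.
rewrite leqNgt; apply/negP=> lt_j.
have : j.*2 ^ m <= (r - 1) ^ m by rewrite leq_exp2r; lia.
by lia.
Qed.

(** The number of letters is even: fewer than (r + 1) / 2 colours give at most r
    letters, whereas (r + 1) / 2 colours, rounded up, give at least r + 1. *)
Lemma OD_minus_not_asymmetric :
  ~ has_asymmetric r m n -> OD_minus (complete_bipartite m n) (uphalf (r + 1)).
Proof.
move=> nas_r; have lt_mn : m < n.
  rewrite ltn_neqAle le_mn andbT; apply/eqP=> eq_mn; apply: nas_r.
  have [-> le_pow] := square_parameters eq_mn.
  by rewrite {1}eq_mn; apply: has_asymmetric_half.
apply: OD_minus_least; first lia.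
  apply: distinguishable_of_asymmetric; first by rewrite lt_mn andbT; lia.
  by apply: (@has_asymmetric_big _ r) => //; lia.
move=> j j_gt0 /asymmetric_of_distinguishable as_j.
rewrite leqNgt; apply/negP=> lt_j; apply: nas_r.
by apply: has_asymmetric_leq as_j; lia.
Qed.

End Index.

(** * The recursive algorithm *)

Definition log_exp : rexp := Bin OClog (Arg 2) (Arg 0).
Definition pow_exp : rexp := Bin OPow (Arg 2) (Arg 0).
Definition sum_exp : rexp := Bin OAdd (Arg 1) log_exp.
Definition yes_exp : rexp := Bin ODiv (Bin OAdd (Arg 2) (Cst 1)) (Cst 2).
Definition no_exp : rexp := Bin ODiv (Bin OAdd (Arg 2) (Cst 2)) (Cst 2).

(** For arguments (a, b, r) with a <= b, the program tests whether there is an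
    asymmetric a x b matrix over r letters, and returns the corresponding value of
    the index instead of a truth value, so that a recursive call passes its result
    on unchanged. *)
Definition decide_body : rexp :=
  Ite (Bin OLeq (Arg 0) (Cst 1)) yes_exp
    (Ite (Bin OLeq sum_exp pow_exp)
       (Ite (Bin OLeq pow_exp sum_exp)
          (Call [:: log_exp; Arg 0; Arg 2]) yes_exp)
       no_exp).

Section Evaluation.

Variables (w : nat) (body : rexp) (args : seq nat).

Lemma eval_arg i v : v = nth 0 args i -> eval w body args (Arg i) v 1.
Proof. by move=> ->; apply: eval_Arg. Qed.

Lemma eval_bin o e1 e2 u1 u2 v t1 t2 t :
  eval w body args e1 u1 t1 -> eval w body args e2 u2 t2 ->
  v = binop_sem o u1 u2 -> v <= w -> t = t1 + t2 + 1 ->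
  eval w body args (Bin o e1 e2) v t.
Proof. by move=> ev1 ev2 -> lev ->; apply: eval_Bin. Qed.

Lemma eval_if e e1 e2 (b : bool) v t1 t2 t :
  eval w body args e b t1 -> eval w body args (if b then e1 else e2) v t2 ->
  t = t1 + t2 + 1 -> eval w body args (Ite e e1 e2) v t.
Proof.
by move=> ev evb ->; apply: eval_Ite ev _; case: (b) evb.
Qed.

End Evaluation.

Lemma leq_up_log_base q q' a : 1 < q -> q <= q' -> up_log q' a <= up_log q a.
Proof.
move=> q1 leqq'; apply: up_log_min; first exact: leq_trans leqq'.
apply: leq_trans (up_logP a q1) _.
by case: up_log => // k; rewrite leq_exp2r.
Qed.

Lemma leq_iter_up_log j a b :
  a <= b -> iter j (up_log 2) a <= iter j (up_log 2) b.
Proof. by move=> leab; elim: j => //= j; apply: leq_up_log. Qed.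

Lemma iter_logstar n : iter (logstar n) (up_log 2) n <= 1.
Proof. by rewrite /logstar; case: ex_minnP. Qed.

Lemma logstar_gt0 n : 1 < n -> 0 < logstar n.
Proof.
move=> n1; rewrite lt0n; apply/eqP=> eq0; have := iter_logstar n.
by rewrite eq0 /= leqNgt n1.
Qed.

(** The number of rows drops to its logarithm to the base r >= 2 in the recursive
    call, so j bounds the depth of the recursion; each level costs at most 30
    steps.  In the recursive call both r ^ a and a + b get smaller, hence the bound
    w on the values is inherited. *)
Lemma decide_body_correct r w j a b :
  1 < r -> 0 < a -> a <= b -> b <= r ^ a ->
  r ^ a <= w -> a + b <= w -> r + 2 <= w -> iter j (up_log 2) a <= 1 ->
  exists v t, [/\ computes_in decide_body w [:: a; b; r] v t, t <= 30 * j.+1 &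
    (v = uphalf r /\ has_asymmetric r a b) \/
    (v = uphalf (r + 1) /\ ~ has_asymmetric r a b)].
Proof.
move=> r1; elim/ltn_ind: a j b => a IH j b.
move=> a_gt0 leab leb le_w leab_w ler_w iter_a.
have ltLa : up_log r a < a by apply: up_log_lt.
have lt_aw : a < w by apply: leq_trans le_w; apply: ltn_expl.
pose ev := eval w decide_body [:: a; b; r].
have ev_base : ev (Bin OLeq (Arg 0) (Cst 1)) (a <= 1) 3.
  apply: (eval_bin (eval_arg _ _ erefl) (eval_Cst _ _ _)) => //; first lia.
  by case: leqP; lia.
have ev_yes : ev yes_exp (uphalf r) 5.
  apply: (eval_bin (eval_bin (eval_arg _ _ erefl) (eval_Cst _ _ _) erefl _ erefl)
    (eval_Cst _ _ _)) => //=; first [lia | by rewrite divn2; lia].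
have [a_le1|a_gt1] := leqP a 1.
  exists (uphalf r), 9; split; [|lia|left; split=> //].
    by apply: (eval_if ev_base (t2 := 5)) => //; rewrite a_le1.
  have eq_a : a = 1 by lia.
  by move: leb; rewrite eq_a expn1; apply: has_asymmetric_row.
have ev_no : ev no_exp (uphalf (r + 1)) 5.
  apply: (eval_bin (eval_bin (eval_arg _ _ erefl) (eval_Cst _ _ _) erefl _ erefl)
    (eval_Cst _ _ _)) => //=; first [lia | by rewrite divn2; lia].
have ev_log : ev log_exp (up_log r a) 3.
  by apply: (eval_bin (eval_arg _ _ erefl) (eval_arg _ _ erefl)) => //=; lia.
have ev_pow : ev pow_exp (r ^ a) 3.
  by apply: (eval_bin (eval_arg _ _ erefl) (eval_arg _ _ erefl)).
have ev_sum : ev sum_exp (b + up_log r a) 5.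
  by apply: (eval_bin (eval_arg _ _ erefl) ev_log) => //=; lia.
have ev_le1 : ev (Bin OLeq sum_exp pow_exp) (b + up_log r a <= r ^ a) 9.
  by apply: (eval_bin ev_sum ev_pow) => //=; case: leqP; lia.
have ev_le2 : ev (Bin OLeq pow_exp sum_exp) (r ^ a <= b + up_log r a) 9.
  by apply: (eval_bin ev_pow ev_sum) => //=; case: leqP; lia.
have [le_pow|gt_pow] := leqP (b + up_log r a) (r ^ a); last first.
  exists (uphalf (r + 1)), 19; split; [|lia|right; split=> //].
    apply: (eval_if ev_base (t2 := 15)) => //; rewrite leqNgt a_gt1 /=.
    by apply: (eval_if ev_le1 (t2 := 5)) => //; rewrite leqNgt gt_pow.
  by move/(has_asymmetric_up_log r1); rewrite leqNgt gt_pow.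
have [ge_pow|lt_pow] := leqP (r ^ a) (b + up_log r a); last first.
  exists (uphalf r), 29; split; [|lia|left; split=> //].
    apply: (eval_if ev_base (t2 := 25)) => //; rewrite leqNgt a_gt1 /=.
    apply: (eval_if ev_le1 (t2 := 15)) => //; rewrite le_pow.
    by apply: (eval_if ev_le2 (t2 := 5)) => //; rewrite leqNgt lt_pow.
  by apply: has_asymmetric_exists; rewrite ?addn1.
case: j iter_a => [|j] iter_a; first by move: iter_a => /=; lia.
have [|||||||v [t [ev_v le_t vP]]] := IH _ ltLa j a; try lia.
- by rewrite up_log_gt0 r1.
- exact: up_logP.
- by apply: leq_trans le_w; rewrite leq_exp2l // ltnW.
- apply: leq_trans iter_a; rewrite iterSr; apply: leq_iter_up_log.
  exact: leq_up_log_base.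
exists v, (t + 30); split; [|lia|].
  apply: (eval_if ev_base (t2 := t + 26)); [|lia]; rewrite leqNgt a_gt1 /=.
  apply: (eval_if ev_le1 (t2 := t + 16)); [|lia]; rewrite le_pow.
  apply: (eval_if ev_le2 (t2 := 5 + t + 1)); [|lia]; rewrite ge_pow.
  apply: (@eval_Call _ _ _ _ [:: up_log r a; a; r] [:: 3; 1; 1]) => //.
  by case=> [|[|[|i]]] // _; apply: eval_Arg.
have eq_pow : b + up_log r a = r ^ a by apply/eqP; rewrite eqn_leq le_pow.
have [swap unswap] := has_asymmetric_swap eq_pow.
case: vP => -[-> asP]; [left|right]; split=> //; first exact: unswap.
by move/swap.
Qed.

Lemma has_asymmetric_dec r m n :
  1 < r -> 0 < m <= n -> n <= r ^ m ->
  has_asymmetric r m n \/ ~ has_asymmetric r m n.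
Proof.
move=> r1 /andP[m_gt0 le_mn] le_n.
have [||||v [t [_ _ [[_ as_r]|[_ nas_r]]]]] :=
  @decide_body_correct r (r ^ m + (m + n) + (r + 2)) (logstar m) m n r1 m_gt0
    le_mn le_n; try lia; try exact: iter_logstar; [by left | by right].
Qed.

Theorem corollary6 :
  (forall m n r : nat,
     2 <= m -> m <= n -> 2 <= r -> (r - 1) ^ m < n -> n <= r ^ m ->
     [/\ n + up_log r m + 1 <= r ^ m ->
           OD_minus (complete_bipartite m n) (uphalf r),
         r ^ m + 1 <= n + up_log r m ->
           OD_minus (complete_bipartite m n) (uphalf (r + 1))
       & n + up_log r m = r ^ m ->
           OD_minus (complete_bipartite m n) (uphalf r) \/
           OD_minus (complete_bipartite m n) (uphalf (r + 1))])
  /\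
  (exists (body : rexp) (C : nat), forall m n r : nat,
     2 <= m -> m <= n -> 2 <= r -> (r - 1) ^ m < n -> n <= r ^ m ->
     n + up_log r m = r ^ m ->
     exists v t : nat,
       [/\ computes_in body (n ^ C) [:: m; n; r] v t,
           t <= C * logstar n
         & OD_minus (complete_bipartite m n) v]).
Proof.
split=> [m n r m_ge2 le_mn r_ge2 lt_n le_n|].
  split=> [lt_pow|gt_pow|_].
  - exact/OD_minus_asymmetric/has_asymmetric_exists.
  - apply: OD_minus_not_asymmetric => // /(has_asymmetric_up_log r_ge2); lia.
  have [||as_r|nas_r] := @has_asymmetric_dec r m n r_ge2; first lia; first lia.
    by left; apply: OD_minus_asymmetric.
  by right; apply: OD_minus_not_asymmetric.
(* 30 * (logstar n + 1) <= 60 * logstar n. *)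
exists decide_body, 60 => m n r m_ge2 le_mn r_ge2 lt_n le_n eq_n.
have lt_L : up_log r m < m by apply: up_log_lt => //; lia.
have le_w : n + n <= n ^ 60.
  apply: (@leq_trans (n ^ 2)); first by rewrite expnS expn1; nia.
  by rewrite leq_exp2l; lia.
have le_r : r + 2 <= r ^ m.
  apply: (@leq_trans (r ^ 2)); first by rewrite expnS expn1; nia.
  by rewrite leq_exp2l; lia.
have [||||||||v [t [ev_v le_t vP]]] :=
  @decide_body_correct r (n ^ 60) (logstar n) m n; try lia.
  by apply: leq_trans (leq_iter_up_log _ le_mn) (iter_logstar n).
exists v, t; split=> //.
  by have := @logstar_gt0 n; lia.
case: vP => -[-> ?]; first exact: OD_minus_asymmetric.
exact: OD_minus_not_asymmetric.
Qed.
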